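(* Let $G_n=(V,E)$ be a graph with $n$ vertices $V=\{a_1,a_2,\dots,a_n\}$. The following statements hold. (i) [Boundedness] Let $\alpha\in[0,1)$. For all $0<p,q\le\infty$ there exists a constant $C(n,p,q)>0$ such that $$\operatorname{Var}_qM_{\alpha,G_n}f\le C(n,p,q)\operatorname{Var}_pf$$ for all functions $f:V\to\mathbb{R}$. (ii) [Continuity] Let $\alpha\in[0,1)$ and $0<p,q\le\infty$. Let $f:V\to\mathbb{R}$ and consider a sequence of functions $f_j:V\to\mathbb{R}$ such that $\|f_j-f\|_{\widetilde{BV_p(G_n)}}=\operatorname{Var}_p(f_j-f)\to0$ as $j\to\infty$. (1) Assume that $\lim_{j\to\infty}\min_{x\in V}|f(x)-f_j(x)|=0$. Then $$\operatorname{Var}_q\big(M_{\alpha,G_n}f-M_{\alpha,G_n}f_j\big)\to0\quad\text{as } j\to\infty.$$ (2) The convergence in (1) could fail to be true without the extra assumption that $\lim_{j\to\infty}\min_{x\in V}|f(x)-f_j(x)|=0$. (iii) For $\alpha\in[0,1)$ and $0<p\le\infty$, $M_{\alpha,G_n}$ is bounded and continuous from $(BV_p(G_n),\|\cdot\|_{BV_p(G_n)})$ to $(BV_p(G_n),\|\cdot\|_{BV_p(G_n)})$.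
   Context: For a finite graph $G=(V,E)$, $d_G$ is the metric induced by the edges of $G$ (the distance between two vertices is the number of edges in a shortest path connecting them), and $B(e,r)=\{m\in V: d_G(e,m)\le r\}$. For $\alpha\in[0,1)$ and $f:V\to\mathbb{R}$, the (fractional, centered) Hardy-Littlewood maximal function of $f$ along $G$ is $$M_{\alpha,G}f(e)=\max_{r\ge 0}\frac{1}{|B(e,r)|^{1-\alpha}}\sum_{m\in B(e,r)}|f(m)|,\qquad e\in V,$$ the case $\alpha=0$ being the classical maximal function $M_G$. For $0<p<\infty$ the $p$-variation of $f:V\to\mathbb{R}$ is $$\operatorname{Var}_p f=\Big(\frac12\sum_{u\in V}\ \sum_{v\in V:\, d_G(u,v)=1}|f(u)-f(v)|^p\Big)^{1/p},$$ and for $p=\infty$ it is $\operatorname{Var}_\infty f=\max\{|f(u)-f(v)|: d_G(u,v)=1\}$. The space $BV_p(G)$ is $\{f:V\to\mathbb{R}:\operatorname{Var}_pf<\infty\}$. Write $\|f\|_{\widetilde{BV_p(G)}}=\operatorname{Var}_pf$ (which vanishes on constant functions, so is not a norm) and, for a fixed vertex $a_0\in V$, $\|f\|_{BV_p(G)}=\|f\|_{\widetilde{BV_p(G)}}+|f(a_0)|$. *)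

(* Defs.v *)
From HB Require Import structures.
From mathcomp Require Import all_boot all_order all_algebra.
From mathcomp Require Import all_classical all_reals all_analysis.
Set Implicit Arguments.
Unset Strict Implicit.
Unset Printing Implicit Defensive.
Import Order.TTheory GRing.Theory Num.Theory.
Import numFieldNormedType.Exports.
Local Open Scope ring_scope.

(* MathComp-Analysis.  The graph metric takes finite values, so connectedness
   is part of the structure; loops and multiple edges do not affect it. *)
Record cgraph (V : finType) := CGraph {
  edge :> rel V;
  edge_sym : symmetric edge;
  edge_irr : irreflexive edge;
  edge_conn : forall u v : V, connect edge u v
}.

Section Graph.
Variables (R : realType) (V : finType) (G : cgraph V).
Implicit Types (u v e m a : V) (f g : V -> R) (p alpha r : R).

Definition has_walk u v (k : nat) : bool :=
  [exists s : k.-tuple V, path G u s && (last u s == v)].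

Lemma has_walk_ex u v : exists k, has_walk u v k.
Proof.
have /connectP[s us vs] := edge_conn G u v; exists (size s).
by apply/existsP; exists (in_tuple s); rewrite us vs eqxx.
Qed.

Definition gdist u v : nat := ex_minn (has_walk_ex u v).

Definition gball e r : {set V} := [set m : V | (gdist e m)%:R <= r]%SET.

Definition frac_avg alpha f e r : R :=
  (#|gball e r|%:R `^ (1 - alpha))^-1 * \sum_(m in gball e r) `|f m|.

(* A ball is one of finitely many sets, so the supremum is a maximum:
   see [maximal_attained]. *)
Definition maximal alpha f : V -> R := fun e =>
  sup [set frac_avg alpha f e r | r in [set r : R | 0 <= r]]%classic.

(* The exponent ranges over ]0, +oo]; the value at -oo is irrelevant. *)
Definition Var (p : \bar R) f : R :=
  match p with
  | p%:E => (2^-1 * \sum_(u : V) \sum_(v : V | gdist u v == 1%N)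
                      `|f u - f v| `^ p) `^ p^-1
  | +oo%E => \big[Num.max/0]_(u : V)
               \big[Num.max/0]_(v : V | gdist u v == 1%N) `|f u - f v|
  | -oo%E => 0
  end.

Definition normBV (a0 : V) (p : \bar R) f : R := Var p f + `|f a0|.

Lemma maximal_attained alpha f e :
  exists2 r, 0 <= r & maximal alpha f e = frac_avg alpha f e r.
Proof.
pose val (B : {set V}) := (#|B|%:R `^ (1 - alpha))^-1 * \sum_(m in B) `|f m|.
pose isball B := `[< exists2 r, 0 <= r & gball e r = B >].
have ball0 : isball (gball e 0) by apply/asboolP; exists 0.
case: (arg_maxP val ball0) => B /asboolP[r r0 <-] maxB; exists r => //.
have rP : [set frac_avg alpha f e r | r in [set r : R | 0 <= r]]%classic
            (frac_avg alpha f e r) by exists r.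
have ubr : ubound [set frac_avg alpha f e r | r in [set r : R | 0 <= r]]%classic
             (frac_avg alpha f e r).
  by move=> _ [s /= s0 <-]; apply: (maxB (gball e s)); apply/asboolP; exists s.
apply/eqP; rewrite eq_le; apply/andP; split.
  by apply: ge_sup => //; exists (frac_avg alpha f e r).
by apply: ub_le_sup => //; exists (frac_avg alpha f e r).
Qed.

(* The minimum of a function on a finite nonempty type: see
   [minval_attained]. *)
Definition minval g : R := inf (range g).

Lemma minval_attained g (a0 : V) :
  (exists a, minval g = g a) /\ (forall a, minval g <= g a).
Proof.
case: (@arg_minP _ _ _ a0 xpredT g isT) => a _ mina.
suff -> : minval g = g a by split=> [|b]; [exists a | exact: mina].
have lba : lbound (range g) (g a) by move=> _ [b _ <-]; exact: mina.
apply/eqP; rewrite eq_le; apply/andP; split.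
  by apply: ge_inf; [exists (g a) | exists a].
by apply: lb_le_inf => //; exists (g a), a.
Qed.

End Graph.

(* Main.v *)
Require Import Defs.
From HB Require Import structures.
From mathcomp Require Import all_boot all_order all_algebra.
From mathcomp Require Import all_classical all_reals all_analysis.
From mathcomp Require Import ring lra.
Set Implicit Arguments.
Unset Strict Implicit.
Unset Printing Implicit Defensive.
Import Order.TTheory GRing.Theory Num.Theory.
Import numFieldNormedType.Exports.
Local Open Scope classical_set_scope.
Local Open Scope ring_scope.

(** On a finite connected graph every [Var G p] is comparable, with constants
    depending only on the number [n] of vertices and on [p], to the oscillation
    of the function: an edge increment is a term of the variation
    ([edge_le_Var]), a simple path joins any two vertices in at most [n] steps
    ([osc_le_Var]), and there are at most [n ^ 2] increments
    ([Var_le_of_osc]).  All these seminorms being equivalent, what has to be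
    understood is how the maximal operator acts on oscillations and on the
    supremum norm.

    Boundedness.  Let [|f|] have oscillation at most [w] and mean [A] on the
    whole graph.  Then [|f| <= A + w] everywhere, so every fractional average
    is at most [n ^ alpha * (A + w)]; the ball which is the whole graph is
    available at every vertex, so the maximal function is at least
    [n ^ alpha * A].  Its oscillation is thus at most [n ^ alpha * w <= n * w]
    ([maximal_osc]), uniformly in [alpha].

    Continuity.  The maximal operator is [n]-Lipschitz for the supremum norm
    ([maximal_lip]).  The variation of [f_ j - f] together with its size at one
    vertex (a fixed one for [normBV], a minimising one for a sequence) controls
    [f_ j - f] uniformly.

    Failure of continuity.  The variation does not see the constant [-1], but
    the absolute value in the maximal function does: subtracting [1] from the
    indicator of a vertex [a] turns it, up to sign, into the indicator of the
    complement of [a].  The maximal function of the former is strictly larger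
    at [a] than at another vertex [b]; that of the latter is at least as large
    at [b] as at [a].  Their difference is therefore not constant
    ([maximal_shift_lt]), and a constant sequence is a
    counterexample. *)

(** * Variation and oscillation *)

Lemma powR_rootK (R : realType) (x p : R) :
  0 <= x -> 0 < p -> (x `^ p) `^ p^-1 = x.
Proof. by move=> x0 p0; rewrite -powRrM mulfV ?lt0r_neq0 // powRr1. Qed.

Section Oscillation.
Variables (R : realType) (V : finType) (G : cgraph V).
Implicit Types (u v : V) (f g : V -> R) (w : R) (p q : \bar R).

Lemma gdist_refl u : gdist G u u = 0%N.
Proof.
rewrite /gdist; case: ex_minnP => k _ /(_ 0%N) mink.
apply/eqP; rewrite -leqn0; apply: mink.
by apply/existsP; exists [tuple]; rewrite /= eqxx.
Qed.

Lemma gdist_eq1 u v : (gdist G u v == 1%N) = (edge G u v).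
Proof.
rewrite /gdist; case: ex_minnP => k /existsP[s /andP[us /eqP vs]] mink.
apply/eqP/idP => [k1|uv].
  case: s us vs => s /=; rewrite k1; case: s => [//|x [|//]] _ /=.
  by rewrite andbT => ux <-.
apply/eqP; rewrite eqn_leq mink /=; last first.
  by apply/existsP; exists [tuple v]; rewrite /= uv eqxx.
case: k s us vs {mink} => // s us vs.
by move: uv; rewrite -vs [s]tuple0 /= edge_irr.
Qed.

Lemma Var_ge0 p f : 0 <= Var G p f.
Proof.
case: p => [p||] //=; first exact: powR_ge0.
exact: bigmax_ge_id.
Qed.

Lemma edge_le_Var p f u v : (0 < p)%E -> edge G u v ->
  `|f u - f v| <= Var G p f.
Proof.
case: p => [p||] //=; last first.
  move=> _ uv; apply: (bigmax_sup u) => //; apply: (bigmax_sup v) => //.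
  by rewrite gdist_eq1.
rewrite lte_fin => p0 uv.
have pV : 0 <= p^-1 by rewrite invr_ge0 ltW.
rewrite -[X in X <= _](powR_rootK _ p0) //.
pose S x := \sum_(y | gdist G x y == 1%N) `|f x - f y| `^ p.
have inner0 x : 0 <= S x by apply: sumr_ge0 => y _; exact: powR_ge0.
have inner x y : edge G x y -> `|f x - f y| `^ p <= S x.
  move=> xy; rewrite /S (bigD1 y) /=; last by rewrite gdist_eq1.
  by rewrite lerDl sumr_ge0 // => z _; exact: powR_ge0.
apply: ge0_ler_powR => //; rewrite ?nnegrE ?powR_ge0 //.
  by apply: mulr_ge0; [rewrite invr_ge0 | apply: sumr_ge0 => x _; exact: inner0].
(* Every edge is counted with both orientations, which absorbs the 1/2. *)
have uNv : v != u by apply: contraTneq uv => ->; rewrite edge_irr.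
rewrite (eq_bigr S) // (bigD1 u) //= (bigD1 v) //=.
have := inner _ _ uv; have := inner v u; rewrite edge_sym uv (distrC (f v)).
move=> /(_ isT) vu uv'.
have rest : 0 <= \sum_(x | (x != u) && (x != v)) S x.
  by apply: sumr_ge0 => x _; exact: inner0.
by lra.
Qed.

Lemma path_osc f w u s : (forall x y, edge G x y -> `|f x - f y| <= w) ->
  path G u s -> `|f u - f (last u s)| <= (size s)%:R * w.
Proof.
move=> fw; elim: s u => [|x s IH] u /=; first by rewrite subrr normr0 mul0r.
move=> /andP[ux /IH xs]; rewrite -addn1 natrD mulrDl mul1r.
by have := ler_distD (f x) (f u) (f (last x s)); have := fw _ _ ux; lra.
Qed.

(** A simple path has at most [#|V|] edges, hence at most [#|V|] increments to
    add up. *)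
Lemma osc_le_Var p f u v : (0 < p)%E ->
  `|f u - f v| <= #|V|%:R * Var G p f.
Proof.
move=> p0; have /connectP[s us ->] := edge_conn G u v.
case/shortenP: us => s' us' uniqs' _.
apply: (le_trans (path_osc (fun x y => @edge_le_Var p f x y p0) us')).
rewrite ler_wpM2r ?Var_ge0 // ler_nat.
apply: leq_trans (max_card (mem (u :: s'))).
by rewrite (card_uniqP uniqs') /= leqnSn.
Qed.

Lemma sup_le_Var p f a u : (0 < p)%E ->
  `|f u| <= `|f a| + #|V|%:R * Var G p f.
Proof.
move=> p0; have := osc_le_Var f u a p0.
have := ler_normD (f a) (f u - f a); rewrite subrKC; lra.
Qed.

(** At most [n ^ 2] ordered pairs contribute to a finite variation; the
    successor keeps the constant positive for [n = 0]. *)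
Definition var_const (n : nat) q : R :=
  if q is r%:E then (n ^ 2).+1%:R `^ r^-1 else 1.

Lemma var_const_gt0 n q : 0 < var_const n q.
Proof. by case: q => [r||] //=; rewrite powR_gt0. Qed.

Lemma Var_le_of_osc q f w : (0 < q)%E -> 0 <= w ->
  (forall u v, `|f u - f v| <= w) -> Var G q f <= var_const #|V| q * w.
Proof.
case: q => [q||] //=; last first.
  by move=> _ w0 fw; rewrite mul1r; do 2!apply: bigmax_le => // *.
rewrite lte_fin => q0 w0 fw.
have qV : 0 <= q^-1 by rewrite invr_ge0 ltW.
rewrite -[X in _ <= _ * X](powR_rootK _ q0) //.
rewrite -powRM // ?powR_ge0 //.
have wq0 : 0 <= w `^ q by exact: powR_ge0.
have sumP : 0 <= \sum_(u : V) \sum_(v | gdist G u v == 1%N) `|f u - f v| `^ q.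
  by apply: sumr_ge0 => u _; apply: sumr_ge0 => v _; exact: powR_ge0.
apply: ge0_ler_powR => //; rewrite ?nnegrE ?mulr_ge0 // ?invr_ge0 //.
have : \sum_(u : V) \sum_(v | gdist G u v == 1%N) `|f u - f v| `^ q
    <= (#|V| ^ 2)%:R * w `^ q.
  rewrite mulr_natl -mulnn mulrnA -2!sumr_const.
  apply: ler_sum => u _; rewrite big_mkcond /=; apply: ler_sum => v _.
  case: ifP => // _; apply: ge0_ler_powR; rewrite ?nnegrE //.
  exact: ltW.
rewrite -[(#|V| ^ 2).+1]addn1 natrD mulrDl mul1r; lra.
Qed.

Lemma Var_le_of_sup q f w : (0 < q)%E -> 0 <= w ->
  (forall u, `|f u| <= w) -> Var G q f <= var_const #|V| q * (2 * w).
Proof.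
move=> q0 w0 fw; apply: Var_le_of_osc => // [|u v]; first lra.
by have := ler_normB (f u) (f v); have := fw u; have := fw v; lra.
Qed.

End Oscillation.

Arguments var_const : clear implicits.
Arguments var_const_gt0 : clear implicits.

(** * Fractional averages and the maximal function *)

Section Maximal.
Variables (R : realType) (V : finType) (G : cgraph V) (alpha : R).
Hypothesis alpha01 : 0 <= alpha < 1.
Implicit Types (a b e : V) (f g : V -> R) (c r w : R).

Let alpha_ge0 : 0 <= alpha. Proof. by case/andP: alpha01. Qed.
Let alpha_lt1 : 0 < 1 - alpha. Proof. by case/andP: alpha01; lra. Qed.

Lemma gball_center e r : 0 <= r -> e \in gball G e r.
Proof. by move=> r0; rewrite inE gdist_refl. Qed.

Lemma gball_full e :
  gball G e ((\max_(m : V) gdist G e m)%:R : R) = [set: V]%SET.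
Proof. by apply/setP => m; rewrite !inE ler_nat leq_bigmax. Qed.

Lemma natr_powR_frac (k : nat) : (0 < k)%N ->
  (k%:R `^ (1 - alpha))^-1 * k%:R = k%:R `^ alpha :> R.
Proof.
move=> k0; have kP : (0 : R) < k%:R by rewrite ltr0n.
rewrite -[X in _ * X]powRr1 ?ltW // -powRN -powRD; last first.
  by rewrite (gt_eqF kP) implybT.
by congr powR; ring.
Qed.

Lemma natr_powR_frac_le (k n : nat) : (k <= n)%N ->
  k%:R `^ alpha <= n%:R `^ alpha :> R.
Proof. by move=> kn; apply: ge0_ler_powR; rewrite ?nnegrE ?ler_nat. Qed.

Lemma frac_avg_le_maximal f e r : 0 <= r ->
  frac_avg G alpha f e r <= maximal G alpha f e.
Proof.
move=> r0; apply: ub_le_sup; last by exists r.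
(* Balls being subsets of [V], the sum of all averages over subsets of [V]
   bounds each one. *)
pose avg (B : {set V}) := (#|B|%:R `^ (1 - alpha))^-1 * \sum_(m in B) `|f m|.
have avg0 B : 0 <= avg B by rewrite mulr_ge0 ?invr_ge0 ?powR_ge0 // sumr_ge0.
exists (\sum_(B : {set V}) avg B) => _ [s _ <-].
by rewrite (bigD1 (gball G e s)) //= lerDl sumr_ge0.
Qed.

Lemma maximal_ge0 f e : 0 <= maximal G alpha f e.
Proof.
apply: le_trans (frac_avg_le_maximal f e (lexx 0)).
by rewrite mulr_ge0 ?invr_ge0 ?powR_ge0 // sumr_ge0.
Qed.

Lemma full_avg_le_maximal f e :
  (#|V|%:R `^ (1 - alpha))^-1 * \sum_(m : V) `|f m| <= maximal G alpha f e.
Proof.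
apply: le_trans (@frac_avg_le_maximal f e (\max_(m : V) gdist G e m)%:R _) => //.
rewrite /frac_avg gball_full cardsT.
by under [in leRHS]eq_bigl do rewrite inE.
Qed.

(** The fractional average over a ball [B] of the constant [c] is
    [#|B| `^ alpha * c], which is largest for the whole graph. *)
Lemma frac_avg_le_add f g c e r : 0 <= r -> 0 <= c ->
  (forall m, `|f m| <= `|g m| + c) ->
  frac_avg G alpha f e r <= frac_avg G alpha g e r + #|V|%:R `^ alpha * c.
Proof.
move=> r0 c0 fg; rewrite /frac_avg; set B := gball _ _ _.
have B0 : (0 < #|B|)%N by apply/card_gt0P; exists e; exact: gball_center.
apply: (@le_trans _ _ ((#|B|%:R `^ (1 - alpha))^-1 *
                       (\sum_(m in B) `|g m| + #|B|%:R * c))).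
  rewrite ler_wpM2l ?invr_ge0 ?powR_ge0 //.
  by rewrite mulr_natl -sumr_const -big_split /=; apply: ler_sum.
rewrite mulrDr mulrA natr_powR_frac // lerD2l ler_wpM2r //.
exact: natr_powR_frac_le (max_card _).
Qed.

Lemma card_powR_le a : #|V|%:R `^ alpha <= #|V|%:R :> R.
Proof.
have V1 : (1 : R) <= #|V|%:R by rewrite ler1n; apply/card_gt0P; exists a.
rewrite -[leRHS]powRr1 ?ler0n //; apply: ler_powR => //.
by case/andP: alpha01 => _ /ltW.
Qed.

(** The average over the whole graph is available at both vertices, and by the
    choice of [w] no fractional average exceeds it by more than
    [#|V| `^ alpha * w]. *)
Lemma maximal_osc f w a b : (forall u v, `|f u - f v| <= w) ->
  `|maximal G alpha f a - maximal G alpha f b| <= #|V|%:R * w.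
Proof.
move=> fw; have w0 : 0 <= w := le_trans (normr_ge0 _) (fw a a).
have V0 : (0 < #|V|)%N by apply/card_gt0P; exists a.
have VP : (0 : R) < #|V|%:R by rewrite ltr0n.
pose A := #|V|%:R^-1 * \sum_(m : V) `|f m|.
have A0 : 0 <= A by rewrite mulr_ge0 ?invr_ge0 ?ler0n ?sumr_ge0.
have fA m : `|f m| <= A + w.
  rewrite -(ler_pM2l VP) mulrDr mulrA divff ?gt_eqF // mul1r.
  rewrite !mulr_natl -!sumr_const -big_split /=; apply: ler_sum => x _.
  by have := ler_normD (f x) (f m - f x); rewrite subrKC; have := fw m x; lra.
have upper e : maximal G alpha f e <= #|V|%:R `^ alpha * (A + w).
  have [r r0 ->] := maximal_attained G alpha f e.
  apply: le_trans (@frac_avg_le_add f (fun=> 0) (A + w) e r r0 _ _) _.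
  - by rewrite addr_ge0.
  - by move=> m; rewrite normr0 add0r.
  - by rewrite /frac_avg normr0 sumr_const mul0rn mulr0 add0r.
have lower e : #|V|%:R `^ alpha * A <= maximal G alpha f e.
  apply: le_trans (full_avg_le_maximal f e).
  by rewrite -(natr_powR_frac V0) /A -mulrA mulVKf // gt_eqF.
have := ler_wpM2r w0 (card_powR_le a).
have := upper a; have := upper b; have := lower a; have := lower b.
by rewrite mulrDr ler_norml; lra.
Qed.

Lemma maximal_le_add f g c e : 0 <= c -> (forall m, `|f m| <= `|g m| + c) ->
  maximal G alpha f e <= maximal G alpha g e + #|V|%:R * c.
Proof.
move=> c0 fg; have [r r0 ->] := maximal_attained G alpha f e.
apply: (le_trans (frac_avg_le_add e r0 c0 fg)).
by rewrite lerD ?frac_avg_le_maximal // ler_wpM2r // card_powR_le.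
Qed.

Lemma maximal_lip f g c e : (forall m, `|f m - g m| <= c) ->
  `|maximal G alpha f e - maximal G alpha g e| <= #|V|%:R * c.
Proof.
move=> fgc; have c0 : 0 <= c := le_trans (normr_ge0 _) (fgc e).
have fg : maximal G alpha f e <= maximal G alpha g e + #|V|%:R * c.
  apply: maximal_le_add => // m; have := ler_normD (g m) (f m - g m).
  by rewrite subrKC; have := fgc m; lra.
have gf : maximal G alpha g e <= maximal G alpha f e + #|V|%:R * c.
  apply: maximal_le_add => // m; have := ler_normB (f m) (f m - g m).
  by rewrite subKr; have := fgc m; lra.
by rewrite ler_norml; lra.
Qed.

Lemma maximal_le_sup f c e : (forall m, `|f m| <= c) ->
  maximal G alpha f e <= #|V|%:R * c.
Proof.
move=> fc; have c0 : 0 <= c := le_trans (normr_ge0 _) (fc e).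
have := @maximal_le_add f (fun=> 0) c e c0; rewrite normr0 add0r => /(_ fc).
have [r r0 ->] := maximal_attained G alpha (fun=> 0) e.
by rewrite /frac_avg normr0 sumr_const mul0rn mulr0 add0r.
Qed.

(** * A shift by a constant that the maximal function sees *)

Lemma maximal_indicator_self a :
  1 <= maximal G alpha (fun x => (x == a)%:R) a.
Proof.
apply: le_trans (frac_avg_le_maximal _ a (lexx 0)).
have -> : frac_avg G alpha (fun x => (x == a)%:R) a 0 =
    (#|gball G a (0 : R)|%:R `^ (1 - alpha))^-1.
  rewrite /frac_avg (bigD1 a) ?gball_center //= eqxx normr1 big1 ?addr0 ?mulr1 //.
  by move=> m /andP[_ /negbTE ->]; rewrite normr0.
suff -> : gball G a (0 : R) = [set a]%SET by rewrite cards1 powR1 invr1.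
apply/setP => m; rewrite !inE lern0; apply/eqP/eqP => [|->]; last first.
  exact: gdist_refl.
rewrite /gdist; case: ex_minnP => k + _ k0; rewrite k0.
by case/existsP => s; rewrite [s]tuple0 /= => /eqP.
Qed.

(** A ball centred at [b] which meets [a] has at least two points. *)
Lemma maximal_indicator_other a b : a != b ->
  maximal G alpha (fun x => (x == a)%:R) b < 1.
Proof.
move=> ab; have [r r0 ->] := maximal_attained G alpha (fun x => (x == a)%:R) b.
rewrite /frac_avg.
have [aB|aB] := boolP (a \in gball G b r); last first.
  rewrite big1 ?mulr0 // => m mB; case: eqP => [ma|]; last by rewrite normr0.
  by rewrite ma (negbTE aB) in mB.
rewrite (bigD1 a) //= eqxx normr1 big1 ?addr0 ?mulr1; last first.
  by move=> m /andP[_ /negbTE ->]; rewrite normr0.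
have B2 : (1 < #|gball G b r|)%N.
  rewrite (cardsD1 b) gball_center // ltnS; apply/card_gt0P; exists a.
  by rewrite in_setD1 ab.
rewrite invf_lt1 ?powR_gt0 ?ltr0n ?(ltnW B2) //.
suff : 1 `^ (1 - alpha) < #|gball G b r|%:R `^ (1 - alpha) by rewrite powR1.
by rewrite (gt0_ltr_powR alpha_lt1) ?nnegrE ?ltr1n.
Qed.

Lemma sum_norm_indicatorC a (B : {set V}) : a \in B ->
  \sum_(m in B) `|(m == a)%:R - 1| = #|B|%:R - 1 :> R.
Proof.
move=> aB; rewrite (bigD1 a) //= eqxx subrr normr0 add0r.
rewrite (eq_bigr (fun=> 1)); last first.
  by move=> m /andP[_ /negbTE ->]; rewrite sub0r normrN normr1.
apply/eqP; rewrite eq_sym subr_eq eq_sym addrC; apply/eqP.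
by rewrite -{1}[1]/((fun=> 1) a) -(bigD1 a) //= sumr_const.
Qed.

(** With [k] points, [a] among them, the fractional average is
    [k `^ alpha * (1 - 1 / k)], which increases with [k]: at [a] the whole graph
    is optimal, and it is a competitor at [b]. *)
Lemma maximal_indicatorC_le a b :
  maximal G alpha (fun x => (x == a)%:R - 1) a <=
  maximal G alpha (fun x => (x == a)%:R - 1) b.
Proof.
apply: le_trans (full_avg_le_maximal _ b).
have [r r0 ->] := maximal_attained G alpha (fun x => (x == a)%:R - 1) a.
rewrite /frac_avg sum_norm_indicatorC ?gball_center //.
have -> : \sum_(m : V) `|(m == a)%:R - 1| = #|V|%:R - 1 :> R.
  rewrite -cardsT -(sum_norm_indicatorC (finset.in_setT a)).
  by apply: eq_bigl => m; rewrite inE.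
set k := #|gball G a r|.
have k0 : (0 < k)%N by apply/card_gt0P; exists a; exact: gball_center.
have kV : (k <= #|V|)%N := max_card _.
have V0 : (0 < #|V|)%N := leq_trans k0 kV.
have factor (j : nat) : (0 < j)%N ->
    (j%:R `^ (1 - alpha))^-1 * (j%:R - 1) = j%:R `^ alpha * (1 - j%:R^-1) :> R.
  move=> j0; rewrite -natr_powR_frac // -mulrA; congr (_ * _).
  by rewrite mulrBr mulr1 divff // pnatr_eq0 -lt0n.
rewrite !factor //; apply: ler_pM; rewrite ?powR_ge0 //.
- by rewrite subr_ge0 invf_le1 ?ler1n ?ltr0n.
- exact: natr_powR_frac_le.
- by rewrite lerD2l lerN2 lef_pV2 ?posrE ?ltr0n // ler_nat.
Qed.

Lemma maximal_shift_lt a b : a != b ->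
  maximal G alpha (fun x => (x == a)%:R) b
    - maximal G alpha (fun x => (x == a)%:R - 1) b <
  maximal G alpha (fun x => (x == a)%:R) a
    - maximal G alpha (fun x => (x == a)%:R - 1) a.
Proof.
move=> ab; have := maximal_indicator_self a.
by have := maximal_indicator_other ab; have := maximal_indicatorC_le a b; lra.
Qed.

End Maximal.

(** * Boundedness and continuity *)

Lemma Var_maximal_le (R : realType) (V : finType) (G : cgraph V) (alpha : R)
    (p q : \bar R) (f : V -> R) :
  0 <= alpha < 1 -> (0 < p)%E -> (0 < q)%E ->
  Var G q (maximal G alpha f) <=
  var_const R #|V| q * (#|V|%:R * (#|V|%:R * Var G p f)).
Proof.
move=> a01 p0 q0; apply: Var_le_of_osc => // [|u v].
  by rewrite !mulr_ge0 ?Var_ge0.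
by apply: maximal_osc => // x y; exact: osc_le_Var.
Qed.

(** The reference vertex [a] is left arbitrary so as to serve both for the norm,
    where it is fixed, and for a sequence whose minimising vertex may vary. *)
Lemma maximal_dist_le (R : realType) (V : finType) (G : cgraph V) (alpha : R)
    (p : \bar R) (f g : V -> R) (a e : V) :
  0 <= alpha < 1 -> (0 < p)%E ->
  `|maximal G alpha g e - maximal G alpha f e| <=
  #|V|%:R * (`|g a - f a| + #|V|%:R * Var G p (fun x => g x - f x)).
Proof.
move=> a01 p0; apply: maximal_lip => // m.
exact: (sup_le_Var G (fun x => g x - f x) a m p0).
Qed.

Theorem theorem3 (R : realType) (n : nat) :
  (* (i) *)
  (forall p q : \bar R, (0 < p)%E -> (0 < q)%E ->
     exists C : R, 0 < C /\
       forall (V : finType) (G : cgraph V) (alpha : R) (f : V -> R),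
         #|V| = n -> 0 <= alpha < 1 ->
         Var G q (maximal G alpha f) <= C * Var G p f) /\
  (forall (V : finType) (G : cgraph V), #|V| = n ->
   (* (ii) (1) *)
   (forall (alpha : R) (p q : \bar R) (f : V -> R) (f_ : nat -> V -> R),
      0 <= alpha < 1 -> (0 < p)%E -> (0 < q)%E ->
      Var G p (fun x => f_ j x - f x) @[j --> \oo] --> (0 : R) ->
      minval (fun x => `|f x - f_ j x|) @[j --> \oo] --> (0 : R) ->
      Var G q (fun x => maximal G alpha f x - maximal G alpha (f_ j) x)
        @[j --> \oo] --> (0 : R)) /\
   (* (ii) (2) *)
   ((1 < n)%N ->
    forall (alpha : R) (p q : \bar R),
      0 <= alpha < 1 -> (0 < p)%E -> (0 < q)%E ->
      exists (f : V -> R) (f_ : nat -> V -> R),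
        (Var G p (fun x => f_ j x - f x) @[j --> \oo] --> (0 : R)) /\
        ~ (Var G q (fun x => maximal G alpha f x - maximal G alpha (f_ j) x)
             @[j --> \oo] --> (0 : R))) /\
   (* (iii) *)
   (forall (alpha : R) (p : \bar R) (a0 : V),
      0 <= alpha < 1 -> (0 < p)%E ->
      (exists C : R, 0 < C /\ forall f : V -> R,
         normBV G a0 p (maximal G alpha f) <= C * normBV G a0 p f) /\
      (forall (f : V -> R) (eps : R), 0 < eps ->
         exists delta : R, 0 < delta /\ forall g : V -> R,
           normBV G a0 p (fun x => g x - f x) < delta ->
           normBV G a0 p (fun x => maximal G alpha g x - maximal G alpha f x)
             < eps))).
Proof.
split=> [p q p0 q0|V G Vn].
  exists (var_const R n q * (n%:R * n%:R) + 1).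
  have K0 : 0 <= var_const R n q * (n%:R * n%:R).
    by rewrite mulr_ge0 ?mulr_ge0 // ltW // var_const_gt0.
  split=> [|V G alpha f Vn a01]; first by rewrite ltr_wpDl.
  have := Var_maximal_le G f a01 p0 q0; rewrite Vn => /le_trans; apply.
  by rewrite mulrDl mul1r !mulrA lerDl Var_ge0.
split=> [alpha p q f f_ a01 p0 q0 fVar fmin|].
  have bound j :
      Var G q (fun x => maximal G alpha f x - maximal G alpha (f_ j) x) <=
      var_const R #|V| q * (2 * (#|V|%:R *
        (minval (fun x => `|f x - f_ j x|)
         + #|V|%:R * Var G p (fun x => f_ j x - f x)))).
    (* Without a vertex the minimum has no witness, but then both sides are 0. *)
    have [a _|V0] := pickP V; last first.
      apply: Var_le_of_sup => // [|u]; last by have := V0 u.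
      by rewrite (eq_card0 V0) mul0r.
    have [[b minb] _] := minval_attained (fun x => `|f x - f_ j x|) a.
    apply: Var_le_of_sup => // [|u].
      by rewrite minb mulr_ge0 // addr_ge0 // mulr_ge0 // Var_ge0.
    by rewrite minb distrC [X in _ * (X + _)]distrC; exact: maximal_dist_le.
  have toz : (var_const R #|V| q * (2 * (#|V|%:R *
        (minval (fun x => `|f x - f_ j x|)
         + #|V|%:R * Var G p (fun x => f_ j x - f x))))) @[j --> \oo] --> (0 : R).
    have -> : (0 : R) = var_const R #|V| q * (2 * (#|V|%:R * (0 + #|V|%:R * 0))).
      by rewrite !(mulr0, addr0).
    apply: cvgMr; apply: cvgMr; apply: cvgMr.
    by apply: cvgD => //; apply: cvgMr.
  apply: squeeze_cvgr (cvg_cst 0) toz.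
  by near=> j; rewrite Var_ge0 bound.
split=> [n1 alpha p q a01 p0 q0|alpha p a0 a01 p0].
  rewrite -Vn in n1.
  have [a [b [_ _ ab]]] := card_gt1P n1.
  (* A constant sequence: its first variation is 0, its second a fixed nonzero
     number. *)
  exists (fun x => (x == a)%:R), (fun=> fun x => (x == a)%:R - 1); split.
    have -> : Var G p (fun x => ((x == a)%:R - 1) - (x == a)%:R) = 0 :> R.
      apply/eqP; rewrite eq_le Var_ge0 andbT.
      rewrite -[leRHS](mulr0 (var_const R #|V| p)).
      apply: Var_le_of_osc => // u v.
      by rewrite !(addrAC _ (-1)) !subrr sub0r opprB subr0 subrr normr0.
    exact: cvg_cst.
  set d := (X in Var G q X) => d0.
  have Vd0 : Var G q d = 0.
    by rewrite -(cvg_lim _ d0) ?lim_cst.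
  have : d b < d a by exact: maximal_shift_lt.
  have := osc_le_Var G d b a q0; rewrite Vd0 mulr0 normr_le0 subr_eq0.
  by move=> /eqP ->; rewrite ltxx.
set N : R := #|V|%:R; set K : R := var_const R #|V| p.
have K0 : 0 < K := var_const_gt0 R #|V| p.
have N0 : 0 <= N by exact: ler0n.
have normW h : `|h a0| + N * Var G p h <= (N + 1) * normBV G a0 p h.
  rewrite /normBV mulrDl mul1r mulrDr.
  have := mulr_ge0 N0 (normr_ge0 (h a0)); have := Var_ge0 G p h; lra.
split=> [|f eps eps0].
  exists (K * (N * N) + N * (N + 1) + 1); split=> [|f].
    by rewrite ltr_wpDl // addr_ge0 ?mulr_ge0 ?addr_ge0 // ltW.
  have VM := Var_maximal_le G f a01 p0 p0.
  have M0 : `|maximal G alpha f a0| <= N * ((N + 1) * normBV G a0 p f).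
    rewrite ger0_norm ?maximal_ge0 //; apply: maximal_le_sup => // m.
    exact: le_trans (sup_le_Var G f a0 m p0) (normW f).
  rewrite {1}/normBV !mulrDl mul1r.
  have Vle : Var G p f <= normBV G a0 p f by rewrite lerDl.
  have := ler_wpM2l (mulr_ge0 (ltW K0) (mulr_ge0 N0 N0)) Vle.
  have := Var_ge0 G p f; move: VM M0; rewrite -/N -/K !mulrA; lra.
exists (eps / ((2 * K + 1) * (N * (N + 1)) + 1)).
have D0 : 0 < (2 * K + 1) * (N * (N + 1)) + 1.
  by rewrite ltr_wpDl // !mulr_ge0 ?addr_ge0 // ?mulr_ge0 // ltW.
split=> [|g]; first by rewrite divr_gt0.
rewrite ltr_pdivlMr // => small; apply: le_lt_trans small.
set w := normBV G a0 p (fun x => g x - f x).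
have w0 : 0 <= w by rewrite addr_ge0 ?Var_ge0.
have Mw e : `|maximal G alpha g e - maximal G alpha f e| <= N * ((N + 1) * w).
  apply: (le_trans (maximal_dist_le G f g a0 e a01 p0)).
  by rewrite ler_wpM2l // normW.
have Nw0 : 0 <= N * ((N + 1) * w) by rewrite !mulr_ge0 // addr_ge0.
have := Var_le_of_sup G p0 Nw0 Mw; have := Mw a0.
rewrite /normBV -/K; lra.
Unshelve. all: by end_near.
Qed.
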